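(* Let $r,m,n,q,p$ be positive integers, let $A_1,\dots,A_r\in\overline{\mathbb{R}}^{m\times n}$, $B_1,\dots,B_r\in\overline{\mathbb{R}}^{q\times p}$ and $C\in\overline{\mathbb{R}}^{m\times p}$. Put $$D=A_{1}\boxtimes B_{1}^{T}\oplus A_{2}\boxtimes B_{2}^{T}\oplus\cdots\oplus A_{r}\boxtimes B_{r}^{T}.$$ Then the matrix equation $$A_{1}\otimes X\otimes B_{1}\oplus A_{2}\otimes X\otimes B_{2}\oplus\cdots\oplus A_{r}\otimes X\otimes B_{r}=C$$ has a solution $X\in\overline{\mathbb{R}}^{n\times q}$ if and only if $$D\otimes\left(D^{\#}\otimes^{\prime}\mathrm{vec}(C)\right)=\mathrm{vec}(C).$$
   Context: Operations are max-plus: $\overline{\mathbb{R}}=\mathbb{R}\cup\{\varepsilon\}$ with $\varepsilon=-\infty$, and $a\oplus b=\max(a,b)$, $a\otimes b=a+b$. For matrices of compatible sizes, $A\oplus B=(a_{ij}\oplus b_{ij})$, $A\otimes B=\left(\max_k (a_{ik}\otimes b_{kj})\right)$, and for a scalar $\alpha$, $\alpha\otimes A=A\otimes\alpha=(\alpha\otimes a_{ij})$. The operation $\otimes$ (and $\boxtimes$) binds more strongly than $\oplus$. Dual operations on $\mathbb{R}\cup\{-\infty,+\infty\}$: $a\oplus^{\prime}b=\min(a,b)$; $a\otimes^{\prime}b=a+b$ if $\{a,b\}\neq\{-\infty,+\infty\}$, and $(-\infty)\otimes^{\prime}(+\infty)=(+\infty)\otimes^{\prime}(-\infty)=+\infty$.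 For matrices, $A\otimes^{\prime}B=\left(\min_k (a_{ik}\otimes^{\prime}b_{kj})\right)$. The conjugate of $A$ is $A^{\#}=-A^{T}$ (so an entry $-\infty$ of $A$ gives an entry $+\infty$ of $A^{\#}$). When $+\infty$ occurs, $\otimes$ is extended by $(-\infty)\otimes(+\infty)=(+\infty)\otimes(-\infty)=-\infty$ (and $a\otimes b=a+b$ otherwise). Tropical tensor product: for $A=(a_{ij})$ of size $m\times n$ and $B=(b_{ij})$ of size $r\times s$, $A\boxtimes B$ is the $mr\times ns$ block matrix with $r\times s$ blocks, whose $(i,j)$ block is the $m\times n$ matrix $A\otimes b_{ij}$ (the blocks are copies of the first factor $A$ scaled by the entries of the second factor $B$). $\mathrm{vec}(A)$ is the column vector formed by the first column of $A$, followed by the second column, and so on. $B^T$ is the transpose of $B$. *)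

(* Defs.v *)
From mathcomp Require Import all_boot all_order all_algebra.
From mathcomp Require Import constructive_ereal reals.
From mathcomp Require Import mxtens.

Set Implicit Arguments.
Unset Strict Implicit.
Unset Printing Implicit Defensive.

Import Order.TTheory GRing.Theory Num.Theory.
Local Open Scope ring_scope.

Declare Scope maxplus_scope.
Delimit Scope maxplus_scope with MP.

(* Matrices have entries in [\bar R]; those with entries in
   R \cup {-oo} are singled out by [mp_mx].  The conventions of [\bar R] are
   the required ones: (-oo) + (+oo) = -oo for [+%E], and
   (-oo) + (+oo) = +oo for the dual addition [+%dE]. *)
Definition mp_mx (R : realType) (m n : nat) (A : 'M[\bar R]_(m, n)) : Prop :=
  forall i j, A i j <> +oo%E.

Definition mp_add (R : realType) (m n : nat) (A B : 'M[\bar R]_(m, n)) :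
    'M[\bar R]_(m, n) :=
  \matrix_(i, j) maxe (A i j) (B i j).

Definition mp_mul (R : realType) (m n p : nat)
    (A : 'M[\bar R]_(m, n)) (B : 'M[\bar R]_(n, p)) : 'M[\bar R]_(m, p) :=
  \matrix_(i, j) \big[maxe/-oo%E]_(k < n) (A i k + B k j)%E.

Definition mp_scale (R : realType) (m n : nat)
    (A : 'M[\bar R]_(m, n)) (a : \bar R) : 'M[\bar R]_(m, n) :=
  \matrix_(i, j) (A i j + a)%E.

Definition mp_dmul (R : realType) (m n p : nat)
    (A : 'M[\bar R]_(m, n)) (B : 'M[\bar R]_(n, p)) : 'M[\bar R]_(m, p) :=
  \matrix_(i, j) \big[mine/+oo%E]_(k < n) (A i k + B k j)%dE.

Definition mp_conj (R : realType) (m n : nat) (A : 'M[\bar R]_(m, n)) :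
    'M[\bar R]_(n, m) :=
  \matrix_(i, j) (- A^T i j)%E.

(* [mxtens_unindex k] is the pair (k %/ m, k %% m) for [k : 'I_(r * m)], that
   is, the index of the block containing row k, and the row inside that
   block; likewise for columns. *)
Definition mp_tens (R : realType) (m n r s : nat)
    (A : 'M[\bar R]_(m, n)) (B : 'M[\bar R]_(r, s)) :
    'M[\bar R]_(r * m, s * n) :=
  \matrix_(k, l)
    let (i, k') := mxtens_unindex k in
    let (j, l') := mxtens_unindex l in
    mp_scale A (B i j) k' l'.

(* [mxvec] concatenates the rows of a matrix, hence the transpositions. *)
Definition mp_vec (R : realType) (m n : nat) (A : 'M[\bar R]_(m, n)) :
    'cV[\bar R]_(n * m) :=
  (mxvec A^T)^T.

Notation "A ⊕ B" := (mp_add A B)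
  (at level 50, left associativity) : maxplus_scope.
Notation "A ⊗ B" := (mp_mul A B)
  (at level 40, left associativity) : maxplus_scope.
Notation "A ⊗' B" := (mp_dmul A B)
  (at level 40, left associativity) : maxplus_scope.
Notation "A ⊠ B" := (mp_tens A B)
  (at level 40, left associativity) : maxplus_scope.
(* The neutral element [const_mx -oo] is absorbed as soon as [r > 0]. *)
Notation "\bigoplus_ ( i < r ) F" :=
  (\big[@mp_add _ _ _/const_mx -oo%E]_(i < r) F%MP)
  (at level 41, F at level 41, i, r at level 50,
   format "\bigoplus_ ( i  <  r )  F") : maxplus_scope.

Lemma mxvec_index_mxtens m n (i : 'I_m) (j : 'I_n) :
  mxvec_index i j = mxtens_index (i, j).
Proof.
apply: val_inj => /=.
rewrite /enum_rank [@enum_rank_in]unlock /= insubdK; last first.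
  by rewrite cardE [_ \in _]index_mem mem_enum.
rewrite enumT [in LHS]Finite.enum.unlock /= /prod_enum.
have -> : index (i, j) [seq (x1, x2) | x1 <- enum 'I_m, x2 <- enum 'I_n]
        = (index i (enum 'I_m) * n + j)%N.
  move: (enum 'I_m) (mem_enum 'I_m i) => s; rewrite inE.
  elim: s => // a s IH; rewrite inE /= index_cat.
  have [<-|nia] := eqVneq i a.
    rewrite map_f ?mem_enum// mul0n add0n => _.
    rewrite index_map; last by move=> x y [].
    by rewrite index_enum_ord.
  move=> /= si.
  case: ifPn => [/mapP[x _ [ia _]]|_]; first by rewrite ia eqxx in nia.
  by rewrite IH // size_map size_enum_ord mulSn addnA.
by rewrite index_enum_ord.
Qed.

Lemma mp_vecE (R : realType) (m n : nat) (A : 'M[\bar R]_(m, n)) k :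
  mp_vec A k 0 = A (mxtens_unindex k).2 (mxtens_unindex k).1.
Proof.
case: (mxtens_indexP k) => j i.
by rewrite mxtens_indexK /mp_vec mxE -mxvec_index_mxtens mxvecE mxE.
Qed.

(* Main.v *)
Require Import Defs.
From mathcomp Require Import all_boot all_order all_algebra.
From mathcomp Require Import constructive_ereal reals.
From mathcomp Require Import mxtens.

(* By distributivity [D ⊗ vec X] is the vec of the left-hand side of the
   equation, so the equation is the one-sided system [D ⊗ x = vec C].  Since
   [d + x <= c] iff [x <= -d + c] (with the dual sum on the right),
   [x̄ = D^# ⊗' vec C] is the greatest solution of [D ⊗ x <= vec C], whence the
   criterion.  An entry of [x̄] can be [+oo] only where the column of [D] is
   identically [-oo]; there it may be replaced by [-oo]. *)

Local Open Scope ring_scope.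
Local Open Scope maxplus_scope.
Import Order.TTheory GRing.Theory Num.Theory.

Lemma lee_maxplus_residual {R : realType} (d x c : \bar R) :
  (d + x <= c)%E = (x <= (- d + c)%dE)%E.
Proof.
case: d x c => [d| |] [x| |] [c| |] //=;
  rewrite ?leNye ?leey // !lee_fin.
by rewrite addrC [in RHS]addrC lerBrDr.
Qed.

(** The empty maximum causes no exception, since [-oo] absorbs even [+oo]. *)
Lemma adde_bigmaxl {R : realType} {I : finType} (F : I -> \bar R) (x : \bar R) :
  (\big[maxe/-oo]_i F i + x = \big[maxe/-oo]_i (F i + x))%E.
Proof.
by apply: (big_morph (fun y => y + x)%E) => [y z|]; rewrite ?adde_maxl ?addNye.
Qed.

Lemma bigmaxe_leP {R : realType} {I : finType} (F : I -> \bar R) (c : \bar R) :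
  reflect (forall i, F i <= c)%E (\big[maxe/-oo]_i F i <= c)%E.
Proof.
apply: (iffP (bigmax_leP _ _ _ _)) => [[_ Fc] i|Fc]; first exact: Fc.
by split=> [|i _]; rewrite ?leNye.
Qed.

Lemma bigoplusE {R : realType} {r m n : nat}
    (F : 'I_r -> 'M[\bar R]_(m, n)) i j :
  (\bigoplus_(t < r) F t) i j = \big[maxe/-oo%E]_t F t i j.
Proof.
by apply: (big_morph (fun M : 'M[\bar R]_(m, n) => M i j)) => [M N|];
  rewrite mxE.
Qed.

(** Bounding a maximum above, or a minimum below, bounds every term; so both sides reduce to
    [D i k + x k j <= c i j] for all [i], [j], [k]. *)
Lemma mp_mul_le {R : realType} {m n p : nat} (D : 'M[\bar R]_(m, n))
    (x : 'M[\bar R]_(n, p)) (c : 'M[\bar R]_(m, p)) :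
  (forall i j, (D ⊗ x) i j <= c i j)%E <->
  (forall k j, x k j <= (mp_conj D ⊗' c) k j)%E.
Proof.
split=> [Dxc k j|xDc i j].
  rewrite mxE; apply/bigmin_geP; split=> [|i _]; first exact: leey.
  rewrite !mxE -lee_maxplus_residual.
  by have := Dxc i j; rewrite mxE => /bigmaxe_leP.
rewrite mxE; apply/bigmaxe_leP => k; rewrite lee_maxplus_residual.
by have := xDc k j; rewrite mxE => /bigmin_geP[_ /(_ i isT)]; rewrite !mxE.
Qed.

Lemma mp_mul_homo {R : realType} {m n p : nat} (D : 'M[\bar R]_(m, n))
    (x y : 'M[\bar R]_(n, p)) :
  (forall k j, x k j <= y k j)%E -> forall i j, ((D ⊗ x) i j <= (D ⊗ y) i j)%E.
Proof.
move=> xy i j; rewrite !mxE; apply: le_bigmax2 => k _.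
exact: leeD2l.
Qed.

(** A minimum is [+oo] only if all its terms are, and as [c i j] is not [+oo], the dual sum
    [- D i k + c i j] is [+oo] only through [- D i k]. *)
Lemma mp_dmul_conj_pinfty {R : realType} {m n p : nat} (D : 'M[\bar R]_(m, n))
    (c : 'M[\bar R]_(m, p)) (hc : mp_mx c) {k j} :
  (mp_conj D ⊗' c) k j = +oo%E -> forall i, D i k = -oo%E.
Proof.
move=> xoo i.
have : (+oo <= (mp_conj D ⊗' c) k j)%E by rewrite xoo.
rewrite mxE => /bigmin_geP[_ /(_ i isT)]; rewrite !mxE.
by have := hc i j; case: (c i j) (D i k) => [c'| |] [d| |].
Qed.

Lemma mp_solvableP {R : realType} {m n p : nat} (D : 'M[\bar R]_(m, n))
    (c : 'M[\bar R]_(m, p)) (hc : mp_mx c) :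
  (exists x, mp_mx x /\ D ⊗ x = c) <-> D ⊗ (mp_conj D ⊗' c) = c.
Proof.
split=> [[x [_ Dxc]]|Dc].
  (* With x̄ = [mp_conj D ⊗' c], the chain is D ⊗ x̄ <= c = D ⊗ x <= D ⊗ x̄, the last inequality
     because the solution x lies below x̄. *)
  apply/matrixP => i j; apply: le_anti; apply/andP; split.
    by apply: (mp_mul_le D _ c).2.
  have -> : c i j = (D ⊗ x) i j by rewrite Dxc.
  apply: mp_mul_homo.
  by apply/mp_mul_le => ? ?; rewrite Dxc.
set x := mp_conj D ⊗' c in Dc.
exists (\matrix_(k, j) if x k j == +oo%E then -oo%E else x k j); split.
  by move=> k j; rewrite mxE; case: eqP.
rewrite -[RHS]Dc; apply/matrixP => i j; rewrite !mxE.
apply: eq_bigr => k _; rewrite mxE; case: eqP => // xoo.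
by rewrite (mp_dmul_conj_pinfty _ _ hc xoo i) !addNye.
Qed.

Lemma mp_tens_vec {R : realType} {r m n q p : nat}
    (A : 'I_r -> 'M[\bar R]_(m, n)) (B : 'I_r -> 'M[\bar R]_(q, p))
    (X : 'M[\bar R]_(n, q)) :
  (\bigoplus_(t < r) (A t ⊠ (B t)^T)) ⊗ mp_vec X =
  mp_vec (\bigoplus_(t < r) (A t ⊗ X ⊗ B t)).
Proof.
apply/matrixP => k j0; rewrite ord1 mp_vecE bigoplusE mxE.
case: (mxtens_indexP k) => j i; rewrite mxtens_indexK /=.
(* Row [(j, i)] is row [i] of block row [j], matching the entry [(i, j)] of a matrix under [mp_vec];
   likewise column [(b, a)] meets [X a b]. *)
have DE t b a : (A t ⊠ (B t)^T) (mxtens_index (j, i)) (mxtens_index (b, a)) =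
    (A t i a + B t b j)%E by rewrite mxE !mxtens_indexK !mxE.
(* Elements with the same upper bounds are equal. Testing against an arbitrary [c] turns the
   differently nested maxima over [t], [a], [b] into the same family of inequalities, so no exchange
   of maxima is required. *)
suff le_iff c : (\big[maxe/-oo]_l ((\bigoplus_(t < r) (A t ⊠ (B t)^T))
      (mxtens_index (j, i)) l + mp_vec X l 0%R) <= c)%E <->
    (\big[maxe/-oo]_t (A t ⊗ X ⊗ B t) i j <= c)%E.
  by apply: le_anti; rewrite (le_iff _).2 // (le_iff _).1.
split=> /bigmaxe_leP le_c; apply/bigmaxe_leP.
  move=> t; rewrite mxE; apply/bigmaxe_leP => b.
  rewrite mxE adde_bigmaxl; apply/bigmaxe_leP => a.
  have := le_c (mxtens_index (b, a)).
  rewrite bigoplusE adde_bigmaxl => /bigmaxe_leP/(_ t).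
  by rewrite DE mp_vecE mxtens_indexK addeAC.
move=> l; case: (mxtens_indexP l) => b a.
rewrite bigoplusE adde_bigmaxl; apply/bigmaxe_leP => t.
rewrite DE mp_vecE mxtens_indexK addeAC.
have := le_c t; rewrite mxE => /bigmaxe_leP/(_ b).
by rewrite mxE adde_bigmaxl => /bigmaxe_leP.
Qed.

Lemma mp_vec_surj {R : realType} {m n : nat} (x : 'cV[\bar R]_(n * m)) :
  exists X : 'M[\bar R]_(m, n), mp_vec X = x.
Proof.
by exists (vec_mx x^T)^T; rewrite /mp_vec trmxK vec_mxK trmxK.
Qed.

Lemma mp_vec_inj {R : realType} {m n : nat} :
  injective (@mp_vec R m n).
Proof.
by move=> X Y /trmx_inj /(can_inj mxvecK) /trmx_inj.
Qed.

Lemma mp_mx_vec {R : realType} {m n : nat} (X : 'M[\bar R]_(m, n)) :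
  mp_mx (mp_vec X) <-> mp_mx X.
Proof.
split=> hX i j; last by rewrite ord1 mp_vecE; apply: hX.
by have := hX (mxtens_index (j, i)) 0; rewrite mp_vecE mxtens_indexK.
Qed.

Theorem corollary8 (R : realType) (r m n q p : nat)
    (hr : (0 < r)%N) (hm : (0 < m)%N) (hn : (0 < n)%N)
    (hq : (0 < q)%N) (hp : (0 < p)%N)
    (A : 'I_r -> 'M[\bar R]_(m, n)) (hA : forall i, mp_mx (A i))
    (B : 'I_r -> 'M[\bar R]_(q, p)) (hB : forall i, mp_mx (B i))
    (C : 'M[\bar R]_(m, p)) (hC : mp_mx C) :
  let D := \bigoplus_(i < r) (A i ⊠ (B i)^T) in
  (exists X : 'M[\bar R]_(n, q),
     mp_mx X /\ \bigoplus_(i < r) (A i ⊗ X ⊗ B i) = C) <->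
  D ⊗ (mp_conj D ⊗' mp_vec C) = mp_vec C.
Proof.
move=> D; apply: iff_trans (mp_solvableP D _ ((mp_mx_vec C).2 hC)).
split=> [[X [hX eqC]]|[x [hx Dx]]].
  by exists (mp_vec X); rewrite mp_tens_vec eqC; split=> //; apply/mp_mx_vec.
(* Every vector solution is the vec of a matrix, and injectivity of [mp_vec] brings the equation
   back to matrices. *)
have [X Xx] := mp_vec_surj x; exists X; rewrite -Xx in hx Dx.
by split; [apply/mp_mx_vec|apply: mp_vec_inj; rewrite -mp_tens_vec].
Qed.
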